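(* Let $k\geqslant 2$ be an integer, let $n\geqslant 3$ be an integer with $n\geqslant k$, and let $C_n$ be the cycle graph on $n$ vertices. Then $$\gamma_{k\text{-SRD}}(C_n)=\left\lceil\frac{2k}{2k+1}\,n\right\rceil.$$
   Context: $C_n$ has vertex set $\{a_1,\ldots,a_n\}$ and edge set $\{a_ia_{i+1} : i\in\{1,\ldots,n-1\}\}\cup\{a_na_1\}$. All graphs are finite, simple and undirected; $N(v)$ denotes the set of neighbors of $v$ and $\Delta(G)$ the maximum degree. Let $k\geqslant 1$ be an integer with $|V(G)|\geqslant k$. An attack pattern is a set $P\subseteq V(G)$ with $|P|=k$. A function $f:V(G)\to\{0,1,\ldots,\min(\Delta(G),k)+1\}$ is a proper $k$-SRD ($k$-strong Roman domination) function if for each attack pattern $P$ every vertex $u\in P$ with $f(u)=0$ can be defended by a neighboring vertex, where each vertex $v$ with $f(v)\geqslant 2$ can defend at most $f(v)-1$ of its neighbors in $P$ labeled 0 (and vertices with label $\leqslant 1$ defend no other vertex). That is, for each $P$ there is a map $\delta_P:\{u\in P : f(u)=0\}\to V(G)$ (which may depend on $P$) such that $\delta_P(u)\in N(u)$ and $f(\delta_P(u))\geqslant 2$ for all $u$ in its domain, and $|\delta_P^{-1}(v)|\leqslant f(v)-1$ for every $v$ with $f(v)\geqslant 2$. The weight is $\omega(f)=\sum_{v\in V(G)}f(v)$, and the $k$-SRD number is $\gamma_{k\text{-SRD}}(G)=\min\{\omega(f) : f \text{ is a proper } k\text{-SRD function on } G\}$. *)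

(* Defs.v *)
From mathcomp Require Import all_boot all_order all_algebra.

Set Implicit Arguments.
Unset Strict Implicit.
Unset Printing Implicit Defensive.

Record sgraph := SGraph {
  vertex :> finType;
  adj : rel vertex;
  adj_sym : symmetric adj;
  adj_irrefl : irreflexive adj
}.

Definition nbh (G : sgraph) (v : G) : {set G} := [set u | adj v u].

Definition max_degree (G : sgraph) : nat := \max_(v : G) #|nbh v|.

(* The labels 0, ..., min(Delta(G), k) + 1. *)
Definition labeling (k : nat) (G : sgraph) : Type :=
  {ffun G -> 'I_(minn (max_degree G) k).+2}.

(* A defense strategy is a map from the vertices of P labeled 0 to the vertices
   of G; it is represented by a total map whose values elsewhere are ignored. *)
Definition defends (k : nat) (G : sgraph) (f : labeling k G) (P : {set G})
    (delta : {ffun G -> G}) : bool :=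
  [forall (u | (u \in P) && (f u == 0 :> nat)),
     (delta u \in nbh u) && (2 <= f (delta u))]
  && [forall v, (2 <= f v) ==>
       (#|[set u in P | (f u == 0 :> nat) && (delta u == v)]| <= f v - 1)].

Definition proper_srd (k : nat) (G : sgraph) (f : labeling k G) : bool :=
  [forall P : {set G}, (#|P| == k) ==>
     [exists delta : {ffun G -> G}, defends f P delta]].

Definition weight (k : nat) (G : sgraph) (f : labeling k G) : nat :=
  \sum_(v : G) f v.

Lemma srd_weight_exists (k : nat) (G : sgraph) :
  exists w, [exists f : labeling k G, proper_srd f && (weight f == w)].
Proof.
pose f : labeling k G := [ffun=> lift ord0 ord0].
have f1 (v : G) : f v = 1 :> nat by rewrite ffunE.
exists (weight f); apply/existsP; exists f; rewrite eqxx andbT.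
apply/forallP=> P; apply/implyP=> _; apply/existsP; exists [ffun u => u].
apply/andP; split; apply/forallP=> u; first by rewrite f1 andbF.
by rewrite f1.
Qed.

Definition srd_number (k : nat) (G : sgraph) : nat :=
  ex_minn (srd_weight_exists k G).

Section Cycle.
Variables (n : nat) (n_ge3 : 3 <= n).

(* The vertex a_(i+1) is i : 'I_n; cycle_arc lists each edge in one direction. *)
Definition cycle_arc (i j : 'I_n) : bool :=
  (j == i.+1 :> nat) || (i == n.-1 :> nat) && (j == 0 :> nat).

Definition cycle_adj : rel 'I_n := fun i j => cycle_arc i j || cycle_arc j i.

Lemma cycle_adj_sym : symmetric cycle_adj.
Proof. by move=> i j; rewrite /cycle_adj orbC. Qed.

Lemma cycle_adj_irrefl : irreflexive cycle_adj.
Proof.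
move=> i; rewrite /cycle_adj orbb /cycle_arc ltn_eqF //=.
by apply/negP=> /andP[/eqP-> ]; case: n n_ge3 => [|[|m]].
Qed.

Definition cycle_graph : sgraph := SGraph cycle_adj_sym cycle_adj_irrefl.

End Cycle.

(* Main.v *)
(* The value is n - floor (n / (2k + 1)).

   Upper bound: on blocks of 2k + 1 consecutive vertices use the labels
   0 2 0 2 ... 2 0, and 1 elsewhere. A block has k + 1 zeros, so some zero z of
   it is not attacked; the attacked zeros before z are defended by their right
   neighbor, those after z by their left neighbor.

   Lower bound: in a proper labeling, consider the maximal alternating runs of
   zeros and of labels at least 2. Only a run 0 2 0 2 ... 2 0 has more zeros
   than its strong vertices can defend, and then by exactly one; it must contain
   at least k + 1 zeros, since otherwise attacking all of them violates Hall's
   condition. Hence the deficit n - w is at most the number of disjoint runs of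
   length at least 2k + 1. To avoid cutting the cycle into runs, the counting is
   done by a potential that depends only on a bounded stretch of labels and
   telescopes around the cycle. *)

Require Import Defs.
From mathcomp Require Import all_boot all_order all_algebra.
From mathcomp Require Import zify.

Set Implicit Arguments.
Unset Strict Implicit.
Unset Printing Implicit Defensive.

(** * Attack patterns and Hall's condition *)

Lemma superset_card (T : finType) (Z : {set T}) (k : nat) :
  #|Z| <= k -> k <= #|T| -> exists2 P : {set T}, Z \subset P & #|P| = k.
Proof.
move=> leZk lekT; pose A := [set x in take (k - #|Z|) (enum (~: Z))].
have cA : #|A| = k - #|Z|.
  rewrite cardsE (card_uniqP _) ?take_uniq ?enum_uniq //.
  rewrite size_takel // -cardE; have := cardsC Z; lia.
have dZA : Z :&: A = set0.
  apply/setP=> x; rewrite !inE; apply/andP=> -[xZ /mem_take].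
  by rewrite mem_enum inE xZ.
exists (Z :|: A); first exact: subsetUl.
by rewrite cardsU dZA cards0 cA; lia.
Qed.

(** The set [Z] extends to an attack pattern of exactly [k] vertices. Its defense sends [Z] into
    [S], and the fibre over [v] has at most [f v - 1] elements. *)
Lemma srd_hall (k : nat) (G : sgraph) (f : labeling k G) (Z S : {set G}) :
    k <= #|G| -> proper_srd f -> #|Z| <= k ->
    {in Z, forall z, f z = 0 :> nat} ->
    (forall z v, z \in Z -> v \in nbh z -> 2 <= f v -> v \in S) ->
    {in S, forall v, 2 <= f v} ->
  #|Z| <= \sum_(v in S) (f v - 1).
Proof.
move=> lekG /forallP fP /superset_card/(_ lekG)[P sZP cP] Z0 nbhS S2.
have /existsP[d /andP[/forallP d1 /forallP d2]] :=
  implyP (fP P) (introT eqP cP).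
have dS z : z \in Z -> d z \in S.
  move=> zZ; have /andP[dz1 dz2] : (d z \in nbh z) && (2 <= f (d z)).
    by have := d1 z; rewrite (subsetP sZP) // (Z0 z) //= eqxx.
  exact: nbhS dz1 dz2.
rewrite -sum1_card (partition_big d (mem S)) //=.
apply: leq_sum => v vS; apply: leq_trans (implyP (d2 v) (S2 v vS)).
rewrite sum1_card; apply: subset_leq_card; apply/subsetP=> u.
rewrite !inE => /andP[uZ ->]; rewrite (subsetP sZP) // Z0 //=.
Qed.

(** * Debts of alternating runs *)

(* The debt of a vertex labeled 0 is k minus the number of further zeros of the
   alternating run 0 2 0 2 ... 0 that starts there, provided that this run stops
   at a label smaller than 2; it vanishes if the run meets a surplus, or if it
   goes on for k steps. The fuel m bounds the length of the run. *)
Fixpoint debt (T : Type) (s : T -> T) (f : T -> nat) (k m : nat) (i : T) :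
    nat :=
  if m is m'.+1 then
    if f (s i) < 2 then k
    else if (f (s i) == 2) && (f (s (s i)) == 0)
    then (debt s f k m' (s (s i))).-1 else 0
  else 0.

Lemma debt_le (T : Type) (s : T -> T) (f : T -> nat) (k m : nat) (i : T) :
  debt s f k m i <= k.
Proof.
elim: m i => [|m IH] i //=; case: ifP => // _; case: ifP => // _.
exact: leq_trans (leq_pred _) (IH _).
Qed.

(** Running out of fuel gives 0 in place of a value at most [k]; the [m] predecessors taken on the
    way back shrink this gap to at most [k - m]. *)
Lemma debt_fuel (T : Type) (s : T -> T) (f : T -> nat) (k m : nat) (i : T) :
  m <= k -> debt s f k m.+1 i - (k - m) = debt s f k m i - (k - m).
Proof.
elim: m i => [|m IH] i lemk.
  by rewrite subn0; have := debt_le s f k 1 i; rewrite [debt _ _ _ 0 _]/=; lia.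
rewrite [in RHS]/= [LHS]/= -/(debt s f k m.+1 (s (s i))).
case: ifP => // _; case: ifP => // _.
by have := IH (s (s i)) (ltnW lemk); lia.
Qed.

Lemma debt_stable (T : Type) (s : T -> T) (f : T -> nat) (k : nat) (i : T) :
  debt s f k k.+1 i = debt s f k k i.
Proof. by have := debt_fuel s f i (leqnn k); rewrite subnn !subn0. Qed.

(** [Z] collects the zeros of the run and [l] is the last one. Since [#|Z|] is only bounded from
    above, a run that revisits vertices does no harm. *)
Lemma debt_run (T : finType) (s : T -> T) (f : T -> nat) (k m : nat) (i : T) :
    f i = 0 -> 0 < debt s f k m i ->
  exists (Z : {set T}) (l : T),
    [/\ l \in Z, i \in Z & #|Z| + debt s f k m i <= k.+1] /\
    [/\ {in Z, forall z, f z = 0}, f (s l) < 2,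
        {in Z, forall z, z != l -> f (s z) = 2}
      & {in Z, forall z, z != i -> exists2 z', z' \in Z & z = s (s z')}].
Proof.
elim: m i => [|m IH] i //= fi0; case: ifPn => [si2 _ | si2].
  exists [set i], i; rewrite set11 cards1; split=> //.
  by split=> // z /set1P-> //; rewrite eqxx.
case: ifP => // /andP[/eqP fsi /eqP fssi] gt0.
have [||Z [l [[lZ iZ cZ] [Z0 sl2 Z2 Zs]]]] := IH (s (s i)) => //; first lia.
exists (i |: Z), l; rewrite !inE eqxx lZ orbT; split; split=> //.
- by rewrite cardsU1; case: (i \notin Z); lia.
- by move=> z /setU1P[->|/Z0].
- by move=> z /setU1P[->|/Z2].
move=> z /setU1P[->|zZ] zi; first by rewrite eqxx in zi.
have [->|/(Zs z zZ)[z' z'Z ->]] := eqVneq z (s (s i)).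
  by exists i; rewrite ?setU11.
by exists z' => //; rewrite setU1r.
Qed.

(** * Lower bound on the cycle *)

Lemma cycle_nbh (n : nat) (n_ge3 : 3 <= n) (i j : cycle_graph n_ge3) :
  (j \in nbh i) = (j == ordS i) || (i == ordS j).
Proof.
have arcE (a b : 'I_n) : cycle_arc a b = (b == ordS a).
  rewrite /cycle_arc -val_eqE /=; have := ltn_ord a; have := ltn_ord b.
  move=> ltb lta; case: (ltnP a.+1 n) => h; first by rewrite modn_small //; lia.
  have -> : a.+1 = n by lia.
  by rewrite modnn; lia.
by rewrite inE /= /cycle_adj !arcE.
Qed.

(** Otherwise the run from [i] has at most [k] zeros, and their strong neighbors are just the 2s
    between them, one fewer: Hall's condition fails. *)
Lemma zero_debt (k n : nat) (n_ge3 : 3 <= n)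
    (f : labeling k (cycle_graph n_ge3)) (i : 'I_n) :
    k <= n -> proper_srd f -> f i = 0 :> nat -> f (ord_pred i) < 2 ->
  debt (@ordS n) (fun v => f v) k k i = 0.
Proof.
move=> lekn fP fi0 fp2; apply/eqP; rewrite eqn0Ngt; apply/negP => gt0.
have [Z [l [[lZ iZ cZ] [Z0 sl2 Z2 Zs]]]] :=
  debt_run (f := fun v => f v) fi0 gt0.
pose S : {set 'I_n} := (@ordS n) @: (Z :\ l).
have S2 : {in S, forall v, f v = 2 :> nat}.
  by move=> v /imsetP[z /setD1P[zl zZ] ->]; apply: Z2.
have : #|Z| <= \sum_(v in S) (f v - 1).
  apply: (srd_hall (G := cycle_graph n_ge3) _ fP) => //.
  - by rewrite card_ord.
  - by rewrite -ltnS (leq_trans _ cZ) // -addn1 leq_add2l.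
  - move=> z v zZ; rewrite cycle_nbh => /orP[/eqP-> | /eqP zE] f2.
      apply: imset_f; rewrite !inE zZ andbT; apply: contraTneq f2 => ->.
      by rewrite -ltnNge.
    have zi : z != i.
      by apply: contraTneq f2 => zi; rewrite -(ordSK v) -zE zi -ltnNge.
    have [z' z'Z zE'] := Zs z zZ zi.
    have vE : v = ordS z' by apply: ordS_inj; rewrite -zE -zE'.
    rewrite vE; apply: imset_f; rewrite !inE z'Z andbT.
    by apply: contraTneq f2 => z'l; rewrite vE z'l -ltnNge.
  by move=> v /S2->.
rewrite (eq_bigr (fun=> 1)); last by move=> v /S2->.
rewrite sum1_card card_imset; last exact: ordS_inj.
by rewrite (cardsD1 l Z) lZ add1n ltnn.
Qed.

Lemma srd_weight_ge (k n : nat) (n_ge3 : 3 <= n)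
    (f : labeling k (cycle_graph n_ge3)) :
  k <= n -> proper_srd f -> 2 * k * n <= (2 * k + 1) * weight f.
Proof.
move=> lekn fP; pose e (i : 'I_n) := debt (@ordS n) (fun v => f v) k k i.
(* Amortization: a potential that drops by at most (2k + 1) f v - 2k across
   the vertex v. *)
pose W (i : 'I_n) : nat :=
  if f (ordS i) == 0 :> nat then 2 * (k - e (ordS i))
  else if f (ordS i) == 1 :> nat then 2 * k else 2 * k + 2 * (k - e i).
have ek i : e i <= k by exact: debt_le.
have e0 i : f i < 2 -> f (ordS i) = 0 :> nat -> e (ordS i) = 0.
  by move=> fi2 fsi0; apply: zero_debt; rewrite ?ordSK.
have eS i : e i = if f (ordS i) < 2 then k else
    if (f (ordS i) == 2 :> nat) && (f (ordS (ordS i)) == 0 :> nat)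
    then (e (ordS (ordS i))).-1 else 0.
  by rewrite /e -debt_stable.
have stepW i : 2 * k + W i <= W (ordS i) + (2 * k + 1) * f (ordS i).
  have := ek i; have := ek (ordS i); have := ek (ordS (ordS i)).
  have := e0 (ordS i); have := eS i; have := eS (ordS i); rewrite /W.
  move: (e i) (e (ordS i)) (e (ordS (ordS i))) => a b c.
  move: (nat_of_ord (f (ordS i))) (nat_of_ord (f (ordS (ordS i)))) => x y.
  case: x => [|[|[|x]]] /=; case: y => [|[|y]] //=; nia.
(* Sums are invariant under rotation, so the potential cancels around the cycle. *)
have sumS F : \sum_(i < n) F (ordS i) = \sum_(i < n) F i :> nat.
  by rewrite [RHS](reindex_inj (@ordS_inj n)).
have := leq_sum (index_enum 'I_n) (P := xpredT) (fun i _ => stepW i).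
rewrite [leqLHS]big_split [leqRHS]big_split /=.
rewrite sum_nat_const card_ord (sumS W) -big_distrr /=.
by rewrite (sumS (fun i => f i)) addnC leq_add2l mulnC.
Qed.

Lemma srd_number_le (k : nat) (G : sgraph) (f : labeling k G) :
  proper_srd f -> srd_number k G <= weight f.
Proof.
move=> fP; rewrite /srd_number; case: ex_minnP => w _; apply.
by apply/existsP; exists f; rewrite fP eqxx.
Qed.

Lemma srd_number_attained (k : nat) (G : sgraph) :
  exists2 f : labeling k G, proper_srd f & weight f = srd_number k G.
Proof.
rewrite /srd_number; case: ex_minnP => w /existsP[f /andP[fP /eqP fw]] _.
by exists f.
Qed.

(** * Upper bound by the block labeling *)

(* Consecutive blocks 0 2 0 2 ... 2 0 of 2k + 1 vertices, followed by 1s. *)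
Definition block_label (k n i : nat) : nat :=
  if i < n %/ (2 * k + 1) * (2 * k + 1)
  then (if odd (i %% (2 * k + 1)) then 2 else 0) else 1.

(** A full block weighs [2 * k], one less than its length. *)
Lemma block_label_sum (k n : nat) :
  \sum_(i < n) block_label k n i + n %/ (2 * k + 1) = n.
Proof.
set q := n %/ _; have qn : q * (2 * k + 1) <= n by exact: leq_divM.
rewrite -(big_mkord xpredT) (big_cat_nat (leq0n _) qn) //=.
rewrite [X in _ + X + _ = _](eq_big_nat _ _ (F2 := fun=> 1)); last first.
  by move=> i /andP[le_i _]; rewrite /block_label ltnNge le_i.
rewrite sum_nat_const_nat muln1 big_nat_mul.
rewrite (eq_big_nat _ _ (F2 := fun=> 2 * k)); last first.
  move=> b /andP[_ ltbq]; rewrite -{1}[b * _]add0n big_addn mulSn addnK.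
  rewrite (eq_big_nat _ _ (F2 := fun i => (odd i).*2)); last first.
    move=> i /andP[_ lti]; rewrite /block_label ifT; last by nia.
    by rewrite addnC modnMDl modn_small //; case: odd.
  elim: (k) => [|k' IH]; first by rewrite big_nat1.
  have -> : 2 * k'.+1 + 1 = (2 * k' + 1).+2 by lia.
  by rewrite !big_nat_recr //= IH; lia.
by rewrite sum_nat_const_nat; lia.
Qed.

(** Together with [0 < k], this makes the label 2 admissible. *)
Lemma cycle_max_degree (n : nat) (n_ge3 : 3 <= n) :
  0 < max_degree (cycle_graph n_ge3).
Proof.
have i : 'I_n by exists 0; lia.
apply: leq_trans (leq_bigmax (F := fun v => #|nbh v|) (i : cycle_graph n_ge3)).
by apply/card_gt0P; exists (ordS i); rewrite cycle_nbh eqxx.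
Qed.

(** Pigeonhole: [k + 1] alternate positions, at most [k] attacks. *)
Lemma unattacked_offset (k n i : nat) (P : {set 'I_n}) :
    i + 2 * k < n -> #|P| <= k ->
  exists2 c, c <= k & forall j : 'I_n, j = i + 2 * c :> nat -> j \notin P.
Proof.
move=> ltn cP.
have bound (c : 'I_k.+1) : i + 2 * c < n by have := ltn_ord c; lia.
pose v c := Ordinal (bound c).
have v_inj : injective v.
  by move=> c d /(congr1 val) /= h; apply: val_inj => /=; lia.
have [sub | /subsetPn[_ /imsetP[c _ ->] vP]] := boolP (v @: setT \subset P).
  have := subset_leq_card sub.
  by rewrite card_imset // cardsT card_ord leqNgt ltnS cP.
exists c; first by rewrite -ltnS.
by move=> j jE; rewrite (_ : j = v c) //; apply: val_inj.
Qed.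

Lemma block_labeling_proper (k n : nat) (n_ge3 : 3 <= n)
    (f : labeling k (cycle_graph n_ge3)) :
  0 < k -> (forall i : 'I_n, f i = block_label k n i :> nat) -> proper_srd f.
Proof.
move=> k_gt0 fE; apply/forallP => P; apply/implyP => /eqP cP.
pose K := 2 * k + 1; have KE : K = 2 * k + 1 by [].
have {}fE (i : 'I_n) : f i = (if i < n %/ K * K
  then (if odd (i %% K) then 2 else 0) else 1) :> nat by exact: fE.
clearbody K; apply/existsP.
(* A zero that still has an unattacked zero after it in its block is defended
   from the right, any other one from the left. *)
pose R (i : 'I_n) := [exists j : 'I_n,
  [&& j %/ K == i %/ K, i < j, ~~ odd (j %% K) & j \notin P]].
have RP (i j : 'I_n) : j %/ K = i %/ K -> i < j -> ~~ odd (j %% K) ->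
    ~~ R i -> j \in P.
  move=> jK ij oj; apply: contraR => jP; apply/existsP; exists j.
  by rewrite jK eqxx ij oj.
exists [ffun i => if R i then ordS i else ord_pred i].
have zeroE (i : 'I_n) : f i = 0 :> nat ->
    i < n %/ K * K /\ ~~ odd (i %% K).
  by rewrite fE; case: ifP => // _; case: odd.
have K0 : 0 < K by lia.
have right (i : 'I_n) : f i = 0 :> nat -> R i ->
    [/\ ordS i = i.+1 :> nat, f (ordS i) = 2 :> nat & i.+1 %/ K = i %/ K].
  move=> /zeroE[iq oi] /existsP[j /and4P[/eqP jK ij oj jP]].
  have ej := divn_eq j K; have ei := divn_eq i K; rewrite jK in ej.
  have lj := ltn_pmod j K0.
  have d1 : i.+1 %/ K = i %/ K.
    by rewrite {1}ei -addnS divnMDl // [X in _ + X]divn_small ?addn0 //; lia.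
  have m1 : i.+1 %% K = (i %% K).+1.
    by have := divn_eq i.+1 K; rewrite d1; lia.
  have iS : ordS i = i.+1 :> nat.
    by rewrite /= modn_small //; have := ltn_ord j; lia.
  split=> //; rewrite fE iS m1 /= oi ifT //.
  by rewrite -ltn_divLR // d1 ltn_divLR.
have left (i : 'I_n) : f i = 0 :> nat -> i \in P -> ~~ R i ->
    [/\ i = (ord_pred i).+1 :> nat, f (ord_pred i) = 2 :> nat
      & ord_pred i %/ K = i %/ K].
  move=> /zeroE[iq oi] iP nR.
  have ei := divn_eq i K; have li := ltn_pmod i K0.
  have ibq : i %/ K < n %/ K by rewrite ltn_divLR.
  (* If [i] began its block, [iP] and [nR] would put all [k + 1] zeros of the block in [P]. *)
  have im0 : 0 < i %% K.
    rewrite lt0n; apply/negP => /eqP im0.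
    have qb : (i %/ K).+1 * K <= n %/ K * K by rewrite leq_mul2r ibq orbT.
    have [||c lec cN] := @unattacked_offset k n i P; [by lia | by rewrite cP |].
    have ltc : i + 2 * c < n by lia.
    have /negP := cN (Ordinal ltc) erefl; apply.
    have [c0|c_gt0] := posnP c.
      by rewrite (_ : Ordinal ltc = i) //; apply: val_inj; rewrite /= c0 addn0.
    have cK : 2 * c < K by lia.
    rewrite im0 addn0 in ei.
    apply: (RP i) => //=; last first.
    - by rewrite {1}ei modnMDl modn_small //; lia.
    - by lia.
    - by rewrite {1}ei divnMDl // [X in _ + X]divn_small // addn0.
  have pE : ord_pred i = i.-1 :> nat.
    have -> : ord_pred i = (i + n).-1 %% n :> nat by [].
    have := ltn_ord i; move: ei im0; case: (i : nat) => [|i'] ei im0 lti.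
      by rewrite mod0n in im0.
    by rewrite addSn /= modnDr modn_small // ltnW.
  have d1 : i.-1 %/ K = i %/ K.
    rewrite {1}ei (_ : (_ + _).-1 = i %/ K * K + (i %% K).-1);
      last by rewrite -!subn1 addnBA.
    rewrite divnMDl // [X in _ + X]divn_small ?addn0 //.
    exact: leq_ltn_trans (leq_pred _) li.
  have m1 : (i.-1 %% K).+1 = i %% K.
    move: (divn_eq i.-1 K) ei im0; rewrite d1.
    by move: (i %/ K * K) (i.-1 %% K) (i %% K) => a b c; lia.
  have io : odd (i.-1 %% K) by move: oi; rewrite -m1 /= negbK.
  split; rewrite ?pE //; first by lia.
  by rewrite fE pE io ifT //; lia.
(* The unattacked zero promised by [R u] differs from the attacked [w], hence comes after [w] in the
   same block, contrary to [~~ R w]. *)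
have clash (u w : 'I_n) : f u = 0 :> nat -> f w = 0 :> nat -> w \in P ->
    R u -> ~~ R w -> ordS u <> ord_pred w.
  move=> u0 w0 wP Ru nRw uw; have [uS _ uK] := right u u0 Ru.
  have [wS _ wK] := left w w0 wP nRw; rewrite -uw uS in wS wK.
  have [_ ou] := zeroE u u0.
  have /existsP[j /and4P[/eqP jK uj oj /negP]] := Ru; apply.
  have [jw|jw] := eqVneq j w; first by rewrite jw.
  apply: (RP w) => //; first by rewrite jK -wK uK.
  have : j != w :> nat by [].
  suff : j != u.+1 :> nat by rewrite wS; lia.
  apply: contraNneq oj => jE; have := divn_eq u.+1 K; rewrite jE uK.
  have := divn_eq u K; move=> {1}-> /eqP.
  by rewrite -addnS eqn_add2l => /eqP <-.
apply/andP; split; apply/forallP => u.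
  apply/implyP => /andP[uP /eqP u0]; rewrite ffunE cycle_nbh.
  case: ifPn => Ru; first by have [_ -> _] := right u u0 Ru; rewrite eqxx.
  by have [_ -> _] := left u u0 uP Ru; rewrite ord_predK eqxx orbT.
apply/implyP => fu; have -> : f u - 1 = 1.
  by move: fu; rewrite fE; do 2?case: ifP.
apply/card_le1_eqP => x y; rewrite !inE !ffunE.
move=> /and3P[xP /eqP x0 /eqP <-] /and3P[yP /eqP y0 /eqP].
case: ifPn => Ry; case: ifPn => Rx.
- by move/ordS_inj.
- by move/clash; case.
- by move/esym/clash; case.
- by move/(can_inj (@ord_predK n)).
Qed.

(** * From the two bounds to the ceiling *)

Lemma srd_number_cycle_ge (k n : nat) (n_ge3 : 3 <= n) :
  k <= n -> 2 * k * n <= (2 * k + 1) * srd_number k (cycle_graph n_ge3).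
Proof.
move=> lekn; have [f fP <-] := srd_number_attained k (cycle_graph n_ge3).
exact: srd_weight_ge.
Qed.

Lemma srd_number_cycle_le (k n : nat) (n_ge3 : 3 <= n) :
  0 < k -> srd_number k (cycle_graph n_ge3) + n %/ (2 * k + 1) <= n.
Proof.
move=> k_gt0; have D0 := cycle_max_degree n_ge3.
pose f : labeling k (cycle_graph n_ge3) :=
  [ffun i : 'I_n => inord (block_label k n i)].
have fE (i : 'I_n) : f i = block_label k n i :> nat.
  rewrite ffunE inordK // /block_label.
  by case: ifP => // _; case: odd => //; rewrite !ltnS leq_min D0.
have /srd_number_le := block_labeling_proper k_gt0 fE.
rewrite -[X in _ -> _ <= X](block_label_sum k n) leq_add2r.
by rewrite /weight (eq_bigr _ (fun i _ => fE i)).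
Qed.

Theorem proposition6 (k n : nat) (k_ge2 : (2 <= k)%N) (n_ge3 : (3 <= n)%N)
    (n_gek : (k <= n)%N) :
  Posz (srd_number k (cycle_graph n_ge3)) =
  Num.ceil ((2 * k)%:R / (2 * k + 1)%:R * n%:R : rat)%R.
Proof.
have lower := srd_number_cycle_ge n_ge3 n_gek.
have upper := srd_number_cycle_le n_ge3 (ltnW k_ge2).
move: (srd_number _ _) lower upper => w lower upper.
have K0 : 0 < 2 * k + 1 by rewrite addn1.
(* The remainder of [n] is below [2 * k + 1]; this turns the floor into the strict inequality that
   characterizes the ceiling. *)
have {}upper : (2 * k + 1) * w < 2 * k * n + (2 * k + 1).
  have := ltn_ceil n K0;
  by move: (n %/ _) upper => q; nia.
apply/esym/Num.Theory.ceil_def; rewrite GRing.mulrAC -!GRing.natrM.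
have K0R : (0 < (2 * k + 1)%:R :> rat)%R by rewrite Num.Theory.ltr0n.
rewrite Num.Theory.ler_pdivrMr // Num.Theory.ltr_pdivlMr //.
rewrite GRing.rmorphB /= -!pmulrn GRing.mulrBl GRing.mul1r Num.Theory.ltrBlDr.
rewrite -!GRing.natrM -GRing.natrD Num.Theory.ltr_nat Num.Theory.ler_nat.
by rewrite mulnC upper.
Qed.
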